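(* Assume that for every universe \(\mathcal T\), the type \(\Omega_{\mathcal T}\) has size \(\mathcal U_0\). Let \(X\) be a poset with carrier in a universe \(\mathcal U\). Then the following are equivalent: (i) \(X\) has suprema for all subsets \(S:X\to\Omega_{\mathcal T}\) (for every universe \(\mathcal T\)); (ii) \(X\) has suprema for all \(\mathcal U\)-covered subsets; (iii) \(X\) has suprema for all subsets whose total spaces have size \(\mathcal U\); (iv) \(X\) has suprema for all families \(I\to X\) with \(I:\mathcal U\).
   Context: Setting: intensional Martin-Löf type theory with universes (\(\mathcal U_0\) the lowest universe), function extensionality, propositional extensionality, propositional truncation. \(\Omega_{\mathcal T}\) is the type of propositions in \(\mathcal T\); a type has size \(\mathcal W\) if it is equivalent to a type in \(\mathcal W\). A poset is a type with a proposition-valued reflexive, transitive, antisymmetric relation. A subset of \(X\) is a map \(S:X\to\Omega_{\mathcal T}\) for some universe \(\mathcal T\); a supremum of \(S\) is a least upper bound of \(\{x : S(x)\}\). The total space of \(S\) is \(\mathbb T(S):=\Sigma_{x:X}S(x)\). \(S\) is \(\mathcal U\)-covered if there is a type \(I:\mathcal U\) with a surjection \(I\twoheadrightarrow\mathbb T(S)\). *)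

(* Defs.v *)
(* Identity types are rendered by Corelib's [eq].  It lives in [Prop], but its
   elimination into [Type] is the full J rule and no K/UIP is assumed; whether
   an identity type is small is decided by the codes [c_id] below, not by its
   sort.  All other propositions are types in [Type] with at most one
   element. *)

Definition is_prop (A : Type) : Prop := forall x y : A, x = y.

Definition is_equiv {A B : Type} (f : A -> B) : Type :=
  {g : B -> A | forall b, f (g b) = b} * {h : B -> A | forall a, h (f a) = a}.

Definition equiv (A B : Type) : Type := {f : A -> B & is_equiv f}.

Infix "≃" := equiv (at level 85, no associativity).

Definition iffT (A B : Type) : Type := (A -> B) * (B -> A).

Infix "<=>" := iffT (at level 95, no associativity).

Definition funext : Prop :=
  forall (A : Type) (B : A -> Type) (f g : forall a, B a),
    (forall a, f a = g a) -> f = g.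

Record prop_trunc := {
  trunc : Type -> Type;
  trunc_is_prop : forall A, is_prop (trunc A);
  tr : forall A, A -> trunc A;
  trunc_rec : forall A P, is_prop P -> (A -> P) -> trunc A -> P
}.

(* Rocq's own universe levels can only be quantified at the head of a
   statement, so the universes of the type theory are taken a la Tarski, with
   codes [A : U] decoded to types [El U A].  The decoding laws hold up to
   equivalence only. *)
Record universe (pt : prop_trunc) := {
  code :> Type;
  El : code -> Type;

  c_empty : code;
  c_unit : code;
  c_nat : code;
  c_sum : code -> code -> code;
  c_pi : forall A : code, (El A -> code) -> code;
  c_sigma : forall A : code, (El A -> code) -> code;
  c_id : forall A : code, El A -> El A -> code;
  c_trunc : code -> code;

  El_empty : El c_empty ≃ Empty_set;
  El_unit : El c_unit ≃ unit;
  El_nat : El c_nat ≃ nat;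
  El_sum : forall A B, El (c_sum A B) ≃ El A + El B;
  El_pi : forall A B, El (c_pi A B) ≃ (forall a : El A, El (B a));
  El_sigma : forall A B, El (c_sigma A B) ≃ {a : El A & El (B a)};
  El_id : forall A x y, El (c_id A x y) ≃ (x = y);
  El_trunc : forall A, El (c_trunc A) ≃ trunc pt (El A)
}.

Arguments El {pt} {u} A : rename.

(* The universes are indexed by a type of levels, so that "for every universe"
   is an ordinary quantifier.  Successor and least upper bound of levels are
   not required: a finite chain of Rocq universes [Type@{i}], with [El] the
   identity, is an instance as soon as each of them has truncations. *)
Record hierarchy (pt : prop_trunc) := {
  level : Type;
  univ :> level -> universe pt;
  level_le : level -> level -> Prop;
  level_le_refl : forall T, level_le T T;
  level_le_trans : forall T T' T'',
    level_le T T' -> level_le T' T'' -> level_le T T'';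
  lift : forall T T', level_le T T' -> univ T -> univ T';
  El_lift : forall T T' (le : level_le T T') (A : univ T),
    El (lift T T' le A) ≃ El A;
  level0 : level;
  level0_le : forall T, level_le level0 T
}.

Arguments level {pt} h.
Arguments level0 {pt} h.

Definition propext {pt} (W : universe pt) : Prop :=
  forall P Q : W, is_prop (El P) -> is_prop (El Q) ->
    (El P -> El Q) -> (El Q -> El P) -> P = Q.

Definition has_size {pt} (W : universe pt) (A : Type) : Type :=
  {B : W & El B ≃ A}.

Definition Omega {pt} (T : universe pt) : Type := {P : T | is_prop (El P)}.

Definition holds {pt} {T : universe pt} (P : Omega T) : Type := El (proj1_sig P).

(* [U] is the universe of the carrier, [V] the one of the order relation. *)
Record poset {pt} (U V : universe pt) := {
  carrier : U;
  order : El carrier -> El carrier -> Omega V;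
  order_refl : forall x, holds (order x x);
  order_trans : forall x y z,
    holds (order x y) -> holds (order y z) -> holds (order x z);
  order_antisym : forall x y,
    holds (order x y) -> holds (order y x) -> x = y
}.

Definition point {pt} {U V : universe pt} (X : poset U V) : Type :=
  El (carrier U V X).

Coercion point : poset >-> Sortclass.

Definition le {pt} {U V : universe pt} {X : poset U V} (x y : X) : Type :=
  holds (order U V X x y).

Infix "⊑" := le (at level 70, no associativity).

Definition subset {pt} (T : universe pt) (A : Type) : Type := A -> Omega T.

Definition total_space {pt} {T : universe pt} {A : Type} (S : subset T A) : Type :=
  {x : A & holds (S x)}.

Definition surjective (pt : prop_trunc) {A B : Type} (f : A -> B) : Type :=
  forall b, trunc pt {a : A | f a = b}.

Definition covered {pt} (U : universe pt) {T : universe pt} {A : Type}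
    (S : subset T A) : Type :=
  {I : U & {e : El I -> total_space S & surjective pt e}}.

(* Suprema are unique by antisymmetry, so having one is a proposition and needs
   no truncation. *)
Definition has_sup_subset {pt} {U V : universe pt} (X : poset U V)
    {T : universe pt} (S : subset T X) : Type :=
  {s : X & ((forall x : X, holds (S x) -> x ⊑ s) *
            (forall y : X, (forall x : X, holds (S x) -> x ⊑ y) -> s ⊑ y))%type}.

Definition has_sup_family {pt} {U V : universe pt} (X : poset U V)
    {I : Type} (a : I -> X) : Type :=
  {s : X & ((forall i : I, a i ⊑ s) *
            (forall y : X, (forall i : I, a i ⊑ y) -> s ⊑ y))%type}.

Definition all_subset_sups {pt} (H : hierarchy pt) {U V : level H}
    (X : poset (H U) (H V)) : Type :=
  forall (T : level H) (S : subset (H T) X), has_sup_subset X S.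

Definition covered_subset_sups {pt} (H : hierarchy pt) {U V : level H}
    (X : poset (H U) (H V)) : Type :=
  forall (T : level H) (S : subset (H T) X),
    covered (H U) S -> has_sup_subset X S.

Definition sized_subset_sups {pt} (H : hierarchy pt) {U V : level H}
    (X : poset (H U) (H V)) : Type :=
  forall (T : level H) (S : subset (H T) X),
    has_size (H U) (total_space S) -> has_sup_subset X S.

Definition family_sups {pt} (H : hierarchy pt) {U V : level H}
    (X : poset (H U) (H V)) : Type :=
  forall (I : H U) (a : El I -> X), has_sup_family X a.

(* Main.v *)
(** Only the step from families to arbitrary subsets uses resizing.  By
    propositional extensionality a proposition [P] of [T] holds iff [P] equals
    the true proposition, and since [Omega T] is equivalent to a type in the
    lowest universe, this equation has a code in every universe.  Hence a
    subset [S] of [X] has the same upper bounds as a family indexed by the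
    points [x] with [S x = true], and this index type is in the universe of the
    carrier.  Conversely, the image of a family indexed in that universe is a
    subset whose total space is in it, because that universe is closed under
    identity types, truncations and sums. *)

Require Import Defs.

Definition equiv_fun {A B : Type} (e : A ≃ B) : A -> B := projT1 e.

Definition equiv_inv {A B : Type} (e : A ≃ B) : B -> A :=
  proj1_sig (fst (projT2 e)).

Lemma equiv_funK {A B : Type} (e : A ≃ B) (b : B) :
  equiv_fun e (equiv_inv e b) = b.
Proof. exact (proj2_sig (fst (projT2 e)) b). Qed.

Lemma equiv_inv_inj {A B : Type} (e : A ≃ B) (b b' : B) :
  equiv_inv e b = equiv_inv e b' -> b = b'.
Proof.
  intros E. rewrite <- (equiv_funK e b), <- (equiv_funK e b'), E. reflexivity.
Qed.

Lemma is_prop_equiv {A B : Type} (e : A ≃ B) : is_prop B -> is_prop A.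
Proof.
  destruct e as [f [_ [h hf]]]. intros pB x y.
  rewrite <- (hf x), <- (hf y). apply f_equal, pB.
Qed.

(** Path induction identifies every [p] with one fixed path built from [pA] alone. *)
Lemma is_prop_eq {A : Type} (pA : is_prop A) (x y : A) : is_prop (x = y).
Proof.
  assert (E : forall p : x = y, p = eq_trans (eq_sym (pA x x)) (pA x y)).
  { intros []. destruct (pA x x). reflexivity. }
  intros p q. rewrite (E p), (E q). reflexivity.
Qed.

Lemma is_prop_is_prop (fe : funext) (A : Type) : is_prop (is_prop A).
Proof.
  intros f g. apply fe. intros x. apply fe. intros y. apply is_prop_eq, f.
Qed.

Lemma trunc_code_is_prop {pt} (U : universe pt) (A : U) :
  is_prop (El (c_trunc pt U A)).
Proof. exact (is_prop_equiv (El_trunc pt U A) (trunc_is_prop pt (El A))). Qed.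

Lemma unit_code_is_prop {pt} (T : universe pt) : is_prop (El (c_unit pt T)).
Proof. apply (is_prop_equiv (El_unit pt T)). intros [] []. reflexivity. Qed.

Definition truth {pt} (T : universe pt) : Omega T :=
  exist _ (c_unit pt T) (unit_code_is_prop T).

Lemma holds_truth {pt} (T : universe pt) : holds (truth T).
Proof. exact (equiv_inv (El_unit pt T) tt). Qed.

Lemma eq_truth (fe : funext) {pt} (T : universe pt) (pe : propext T)
    (P : Omega T) : holds P -> P = truth T.
Proof.
  destruct P as [P pP]. unfold holds, truth; simpl. intros h.
  assert (E : P = c_unit pt T).
  { apply pe; [exact pP | apply unit_code_is_prop | | intros _; exact h].
    intros _. apply holds_truth. }
  (* The proof component depends on the code, so it becomes a variable before [E] is eliminated;
     what remains compares two proofs of [is_prop]. *)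
  generalize (unit_code_is_prop T). destruct E. intros q.
  rewrite (is_prop_is_prop fe _ pP q). reflexivity.
Qed.

(** Assembled from codes of [U] only, so that [c_sigma] also codes its total space. *)
Definition image {pt} {U : universe pt} {A I : U} (a : El I -> El A) :
    subset U (El A) :=
  fun x => exist _ (c_trunc pt U (c_sigma pt U I (fun i => c_id pt U A (a i) x)))
                   (trunc_code_is_prop U _).

Lemma image_intro {pt} {U : universe pt} {A I : U} (a : El I -> El A) (i : El I) :
  holds (image a (a i)).
Proof.
  apply (equiv_inv (El_trunc _ _ _)), tr, (equiv_inv (El_sigma _ _ _ _)).
  exists i. exact (equiv_inv (El_id _ _ _ _ _) eq_refl).
Qed.

Lemma image_rec {pt} {U : universe pt} {A I : U} (a : El I -> El A)
    (P : El A -> Type) (pP : forall x, is_prop (P x)) (f : forall i, P (a i))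
    (x : El A) : holds (image a x) -> P x.
Proof.
  intros h. apply (trunc_rec pt _ _ (pP x)) with (2 := equiv_fun (El_trunc _ _ _) h).
  intros s. destruct (equiv_fun (El_sigma _ _ _ _) s) as [i e].
  destruct (equiv_fun (El_id _ _ _ _ _) e). apply f.
Qed.

Lemma image_sized {pt} {U : universe pt} {A I : U} (a : El I -> El A) :
  has_size U (total_space (image a)).
Proof.
  exists (c_sigma pt U A (fun x => proj1_sig (image a x))).
  apply El_sigma.
Qed.

Lemma sized_covered {pt} {U T : universe pt} {A : Type} (S : subset T A) :
  has_size U (total_space S) -> covered U S.
Proof.
  intros [I e]. exists I, (equiv_fun e). intros b. apply tr.
  exists (equiv_inv e b). apply equiv_funK.
Qed.

Lemma le_is_prop {pt} {U V : universe pt} {X : poset U V} (x y : X) :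
  is_prop (x ⊑ y).
Proof. exact (proj2_sig (order U V X x y)). Qed.

(** A family and its image have the same upper bounds: [⊑] is proposition-valued, so the truncation
    in the image can be eliminated into it. *)
Lemma has_sup_image {pt} {U V : universe pt} (X : poset U V) (I : U)
    (a : El I -> X) :
  has_sup_subset X (image (A := carrier U V X) a) -> has_sup_family X a.
Proof.
  intros [s [ub lub]]. exists s. split.
  - intros i. apply ub, image_intro.
  - intros y hy. apply lub.
    apply (image_rec _ (fun x : X => x ⊑ y)); [|exact hy].
    intros x. apply le_is_prop.
Qed.

Lemma family_sups_all (fe : funext) (pt : prop_trunc) (H : hierarchy pt)
    (pe : forall T : level H, propext (H T))
    (resizing : forall T : level H, has_size (H (level0 H)) (Omega (H T)))
    (U V : level H) (X : poset (H U) (H V)) :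
  family_sups H X -> all_subset_sups H X.
Proof.
  intros sups T S.
  destruct (resizing T) as [B e].
  set (l := El_lift pt H _ _ (level0_le pt H U) B).
  (* [g] carries propositions of [H T] into a copy of [B] in [H U], where [c_id] can compare
     them. *)
  set (g := fun P : Omega (H T) => equiv_inv l (equiv_inv e P)).
  set (D := fun x : X => c_id pt (H U) _ (g (S x)) (g (truth (H T)))).
  set (es := El_sigma pt (H U) (carrier _ _ X) D).
  destruct (sups _ (fun i => projT1 (equiv_fun es i))) as [s [ub lub]].
  exists s. split.
  - intros x hx.
    assert (d : El (D x)).
    { apply (equiv_inv (El_id _ _ _ _ _)).
      rewrite (eq_truth fe _ (pe T) (S x) hx). reflexivity. }
    pose proof (ub (equiv_inv es (existT _ x d))) as h.
    cbv beta in h. rewrite equiv_funK in h. exact h.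
  - intros y hy. apply lub. intros i.
    destruct (equiv_fun es i) as [x d]. cbn [projT1]. apply hy.
    (* Both inverses in [g] are cancelled, leaving [S x = truth (H T)]. *)
    apply (equiv_fun (El_id _ _ _ _ _)), equiv_inv_inj, equiv_inv_inj in d.
    rewrite d. apply holds_truth.
Qed.

Theorem theorem5p8 (fe : funext) (pt : prop_trunc) (H : hierarchy pt)
    (pe : forall T : level H, propext (H T))
    (resizing : forall T : level H, has_size (H (level0 H)) (Omega (H T)))
    (U V : level H) (X : poset (H U) (H V)) :
  (all_subset_sups H X <=> covered_subset_sups H X) *
  (covered_subset_sups H X <=> sized_subset_sups H X) *
  (sized_subset_sups H X <=> family_sups H X).
Proof.
  (* The four implications form a cycle, from which [auto] composes each converse. *)
  assert (c12 : all_subset_sups H X -> covered_subset_sups H X)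
    by (intros h T S _; apply h).
  assert (c23 : covered_subset_sups H X -> sized_subset_sups H X)
    by (intros h T S hS; apply h, sized_covered, hS).
  assert (c34 : sized_subset_sups H X -> family_sups H X)
    by (intros h I a; apply has_sup_image, h, image_sized).
  pose proof (family_sups_all fe pt H pe resizing U V X) as c41.
  repeat split; auto.
Qed.
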